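(* Let $G \in \mathscr S$. Then the centraliser lattice $\mathcal{LC}(G)$, endowed with the operators $\vee'$ (join), $\wedge$ (meet) and $\perp$ (complement), is a Boolean lattice on which $G$ acts by automorphisms.
   Context: $\mathscr S$ denotes the class of compactly generated locally compact groups that are totally disconnected, topologically simple, and non-discrete. A locally normal subgroup of $G$ is a compact subgroup whose normaliser in $G$ is open. Two subgroups are commensurable if their intersection has finite index in each of them. The structure lattice $\mathcal{LN}(G)$ is the set of commensurability classes $[K]$ of locally normal subgroups $K$ of $G$, with the partial order $\leq$ induced by inclusion ($[K] \leq [L]$ iff $K \cap L$ has finite index in $K$). It is a modular lattice with join $\vee$, meet $\wedge$, minimum $0$ (class of the trivial subgroup) and maximum $\infty$ (class of the compact open subgroups). $G$ acts on it by automorphisms via conjugation, $g.[K]=[gKg^{-1}]$. For $\alpha \in \mathcal{LN}(G)$, choose a representative $K$ of $\alpha$ that is a closed normal subgroup of some compact open subgroup $U$ of $G$; the centraliser $\mathrm C_U(K)$ is a locally normal subgroup of $G$ whose commensurability class depends only on $\alpha$, and this class is denoted $\alpha^\perp$. The centraliser lattice is $\mathcal{LC}(G) = \{\alpha^\perp \mid \alpha \in \mathcal{LN}(G)\}$. The operator $\vee'$ is defined by $\alpha \vee' \beta = (\alpha^\perp \wedge \beta^\perp)^\perp$. The $G$-action on $\mathcal{LC}(G)$ is the restriction of the conjugation action on $\mathcal{LN}(G)$. *)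

(* Defs.v *)
From HB Require Import structures.
From mathcomp Require Import all_boot all_order.
From mathcomp Require Import all_classical topology.

Set Implicit Arguments.
Unset Strict Implicit.
Unset Printing Implicit Defensive.

Import Order.TTheory.

Local Open Scope classical_set_scope.
Local Open Scope group_scope.

HB.structure Definition PreTopologicalGroup :=
  {G of Topological G & Group G}.

HB.mixin Record PreTopologicalGroup_isTopologicalGroup G
    & PreTopologicalGroup G := {
  mulg_continuous : continuous (fun x : G * G => x.1 * x.2);
  invg_continuous : continuous (fun x : G => x^-1)
}.

#[short(type="topologicalGroupType")]
HB.structure Definition TopologicalGroup :=
  {G of PreTopologicalGroup G & PreTopologicalGroup_isTopologicalGroup G}.

(* No separation axiom is needed: totally disconnected topological groups are
   Hausdorff, see [tdlc_hausdorff]. *)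
HB.mixin Record TopologicalGroup_isTDLC G & TopologicalGroup G := {
  tdlc_locally_compact : locally_compact [set: G];
  tdlc_totally_disconnected : totally_disconnected [set: G]
}.

#[short(type="tdlcGroupType")]
HB.structure Definition TDLCGroup :=
  {G of TopologicalGroup G & TopologicalGroup_isTDLC G}.

Section Subgroups.
Variable G : groupType.
Implicit Types (g x y : G) (H K L M U : set G).

Definition subgroup K : Prop := group_closed [in K].

Definition lcoset x H : set G := [set x * y | y in H].

Definition conjset g K : set G := [set g * x * g^-1 | x in K].

Definition normaliser K : set G := [set g | conjset g K = K].

Definition centraliser_in U K : set G :=
  [set x | U x /\ forall y, K y -> commute x y].

(* Only meaningful for subgroups H `<=` K. *)
Definition finite_index H K : Prop := finite_set [set lcoset x H | x in K].

Definition virtually_sub K L : Prop := finite_index (K `&` L) K.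

Definition commensurable K L : Prop :=
  finite_index (K `&` L) K /\ finite_index (K `&` L) L.

Lemma subgroupP K :
  subgroup K <-> K 1 /\ forall x y, K x -> K y -> K (x * y^-1).
Proof.
split=> -[K1 KM].
- split; first by have := K1; rewrite inE.
  by move=> x y Kx Ky; have := KM x y; rewrite !inE; exact.
- split; first by rewrite inE.
  by move=> x y; rewrite !inE; exact: KM.
Qed.

Lemma subgroup1 K : subgroup K -> K 1.
Proof. by move/subgroupP => -[]. Qed.

Lemma subgroupV K x : subgroup K -> K x -> K x^-1.
Proof.
by move=> /subgroupP[K1 KM] Kx; rewrite -[x^-1]mul1g; exact: KM.
Qed.

Lemma subgroupM K x y : subgroup K -> K x -> K y -> K (x * y).
Proof.
move=> sK Kx Ky; have /subgroupP[_ KM] := sK.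
by rewrite -[y]invgK; apply: KM => //; exact: subgroupV.
Qed.

Lemma subgroupI K L : subgroup K -> subgroup L -> subgroup (K `&` L).
Proof.
move=> /subgroupP[K1 KM] /subgroupP[L1 LM]; apply/subgroupP; split => //.
by move=> x y [Kx Lx] [Ky Ly]; split; [exact: KM|exact: LM].
Qed.

Lemma lcosetP x H y : lcoset x H y <-> H (x^-1 * y).
Proof.
split=> [[z Hz <-]|Hy]; first by rewrite mulKg.
by exists (x^-1 * y) => //; rewrite mulVKg.
Qed.

Lemma lcoset_eq x y H : subgroup H -> H (x^-1 * y) -> lcoset x H = lcoset y H.
Proof.
move=> sH Hxy; apply/seteqP; split=> z /lcosetP Hz; apply/lcosetP.
- have -> : y^-1 * z = (x^-1 * y)^-1 * (x^-1 * z) by rewrite invgM invgK mulgA mulgK.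
  by apply: subgroupM => //; exact: subgroupV.
- have -> : x^-1 * z = (x^-1 * y) * (y^-1 * z) by rewrite mulgA mulgK.
  exact: subgroupM.
Qed.

Lemma virtually_subP K L : subgroup K -> subgroup L ->
  virtually_sub K L <->
  exists2 F : set G, finite_set F & forall x, K x -> exists2 f, F f & L (f^-1 * x).
Proof.
move=> sK sL; split.
- rewrite /virtually_sub /finite_index => fA.
  exists [set xget 1 C | C in [set lcoset x (K `&` L) | x in K]].
    exact: finite_image.
  move=> x Kx; exists (xget 1 (lcoset x (K `&` L))).
    by exists (lcoset x (K `&` L)) => //; exists x.
  set C := lcoset x _.
  have : C (xget 1 C).
    apply: (@xgetPex _ 1 C); exists x; apply/lcosetP; rewrite mulVg.
    by split; exact: subgroup1.
  move=> /lcosetP[_ /(subgroupV sL)]; by rewrite invgM invgK.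
- move=> [F fF FP].
  apply: (sub_finite_set _ (finite_image (fun f => K `&` lcoset f L) fF)).
  move=> _ [x Kx <-]; have [f Ff Lfx] := FP x Kx; exists f => //=.
  rewrite (lcoset_eq sL Lfx); apply/seteqP; split=> y.
  + move=> [Ky /lcosetP Ly]; apply/lcosetP; split => //.
    by apply: subgroupM => //; exact: subgroupV.
  + move=> /lcosetP[Ky Ly]; split; last exact/lcosetP.
    by rewrite -[y](mulVKg x); exact: subgroupM.
Qed.

Lemma virtually_subxx K L : subgroup K -> subgroup L -> K `<=` L ->
  virtually_sub K L.
Proof.
move=> sK sL KL; apply/virtually_subP => //.
exists [set 1]; first exact: finite_set1.
by move=> x Kx; exists 1 => //; rewrite invg1 mul1g; exact: KL.
Qed.

Lemma virtually_sub_trans K L M : subgroup K -> subgroup L -> subgroup M ->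
  virtually_sub K L -> virtually_sub L M -> virtually_sub K M.
Proof.
move=> sK sL sM /(virtually_subP sK sL)[F fF FP] /(virtually_subP sL sM)[E fE EP].
apply/virtually_subP => //.
exists [set f * e | f in F & e in E]; first exact: finite_image2.
move=> x /FP[f Ff /EP[e Ee Mfe]]; exists (f * e); first by exists f => //; exists e.
by rewrite invgM -mulgA.
Qed.

Lemma virtually_subI K L M : subgroup K -> subgroup L -> subgroup M ->
  virtually_sub K (L `&` M) <-> virtually_sub K L /\ virtually_sub K M.
Proof.
move=> sK sL sM; have sLM := subgroupI sL sM; split.
  by move=> KLM; split; apply: virtually_sub_trans KLM _ => //;
    apply: virtually_subxx => // x [].
move=> [fL fM].
apply: (sub_finite_set _ (finite_image2 setI fL fM)).
move=> _ [x Kx <-]; exists (lcoset x (K `&` L)); first by exists x.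
exists (lcoset x (K `&` M)); first by exists x.
apply/seteqP; split=> y.
- by move=> [/lcosetP[Ky Ly] /lcosetP[_ My]]; apply/lcosetP.
- by move=> /lcosetP[Ky [Ly My]]; split; apply/lcosetP.
Qed.

Lemma commensurableE K L :
  commensurable K L <-> virtually_sub K L /\ virtually_sub L K.
Proof. by rewrite /virtually_sub (setIC L K). Qed.

Lemma conjsetP g K x : conjset g K x <-> K (g^-1 * x * g).
Proof.
split=> [[y Ky <-]|Kx]; first by rewrite !mulgA mulVg mul1g mulgVK.
by exists (g^-1 * x * g) => //; rewrite !mulgA mulgV mul1g mulgK.
Qed.

Lemma conjset1 K : conjset 1 K = K.
Proof.
by apply/seteqP; split=> x; rewrite conjsetP invg1 mul1g mulg1.
Qed.

Lemma conjsetM g h K : conjset (g * h) K = conjset g (conjset h K).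
Proof.
by apply/seteqP; split=> x; rewrite !conjsetP invgM !mulgA.
Qed.

Lemma conjset_subgroup g K : subgroup K -> subgroup (conjset g K).
Proof.
move=> sK; apply/subgroupP; split.
  by apply/conjsetP; rewrite mulg1 mulVg; exact: subgroup1.
move=> x y /conjsetP Kx /conjsetP Ky; apply/conjsetP.
have -> : g^-1 * (x * y^-1) * g = (g^-1 * x * g) * (g^-1 * y * g)^-1.
  by rewrite !invgM invgK !mulgA mulgK.
by apply: subgroupM => //; exact: subgroupV.
Qed.

Lemma conjsetI g K L : conjset g (K `&` L) = conjset g K `&` conjset g L.
Proof.
apply/seteqP; split=> x; first by rewrite conjsetP => -[? ?]; split; apply/conjsetP.
by move=> [/conjsetP ? /conjsetP ?]; apply/conjsetP.
Qed.

Lemma normaliser_subgroup K : subgroup (normaliser K).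
Proof.
apply/subgroupP; split; first exact: conjset1.
move=> x y Nx Ny; rewrite /normaliser/=.
by rewrite -[in LHS]Ny -conjsetM mulgVK.
Qed.

Lemma normaliserJ g K : normaliser (conjset g K) = conjset g (normaliser K).
Proof.
apply/seteqP; split=> x.
- move=> Nx; apply/conjsetP; rewrite /normaliser/= 2!conjsetM Nx.
  by rewrite -conjsetM mulVg conjset1.
- move=> /conjsetP Nx; rewrite /normaliser/= -[in RHS]Nx -!conjsetM.
  by rewrite !mulgA mulgV mul1g.
Qed.

Lemma virtually_subJ g K L : subgroup K -> subgroup L ->
  virtually_sub K L -> virtually_sub (conjset g K) (conjset g L).
Proof.
move=> sK sL /(virtually_subP sK sL)[F fF FP]; apply/virtually_subP.
- exact: conjset_subgroup.
- exact: conjset_subgroup.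
- exists (conjset g F); first exact: finite_image.
  move=> x /conjsetP/FP[f Ff Lf]; exists (g * f * g^-1); first by exists f.
  by apply/conjsetP; rewrite !invgM invgK !mulgA mulVg mul1g -!mulgA mulgA in Lf *.
Qed.

End Subgroups.

Section TopGroup.
Variable G : topologicalGroupType.
Implicit Types (g x : G) (K L : set G).

Lemma lmulg_continuous g : continuous (fun x : G => g * x).
Proof.
move=> x; apply: (@continuous2_cvg _ _ _ _ _ _ _ _ (fun a b : G => a * b) g x).
- exact: (@mulg_continuous G (g, x)).
- exact: cvg_cst.
- exact: cvg_id.
Qed.

Lemma rmulg_continuous g : continuous (fun x : G => x * g).
Proof.
move=> x; apply: (@continuous2_cvg _ _ _ _ _ _ _ _ (fun a b : G => a * b) x g).
- exact: (@mulg_continuous G (x, g)).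
- exact: cvg_id.
- exact: cvg_cst.
Qed.

Lemma conjg_continuous g : continuous (fun x : G => g * x * g^-1).
Proof.
move=> x; apply: (@continuous_comp _ _ _ (fun x => g * x) (fun x => x * g^-1)).
- exact: lmulg_continuous.
- exact: rmulg_continuous.
Qed.

Lemma conjset_open g K : open K -> open (conjset g K).
Proof.
move=> oK; have -> : conjset g K = (fun x => g^-1 * x * g^-1^-1) @^-1` K.
  by apply/seteqP; split=> x; rewrite conjsetP /= invgK.
by apply: open_comp => // x _; exact: conjg_continuous.
Qed.

Lemma conjset_compact g K : compact K -> compact (conjset g K).
Proof.
move=> cK; apply: continuous_compact => //.
by apply: continuous_subspaceT => x; exact: conjg_continuous.
Qed.

Lemma subgroup_open K L : subgroup K -> open L -> L 1 -> L `<=` K -> open K.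
Proof.
move=> sK oL L1 LK; rewrite openE => x Kx.
have nL : nbhs (x^-1 * x) L by rewrite mulVg; exact: open_nbhs_nbhs.
have nxL : nbhs x [set y | L (x^-1 * y)] := @lmulg_continuous x^-1 x _ nL.
rewrite /interior /=; apply: filterS nxL => y /LK Ky.
by rewrite -[y](mulVKg x); exact: subgroupM.
Qed.

End TopGroup.

Lemma tdlc_hausdorff (G : tdlcGroupType) : hausdorff_space G.
Proof.
have cl1 (x : G) : closed [set x].
  rewrite -(@tdlc_totally_disconnected G x I).
  by apply: component_closed; exact: closedT.
rewrite open_hausdorff => x y xy.
have oN : open (~` [set x^-1 * y]) by rewrite openC; exact: cl1.
have N1 : (~` [set x^-1 * y]) (1 * 1^-1 : G).
  rewrite /= invg1 mulg1 => /(congr1 (fun z => x * z)); rewrite mulg1 mulVKg.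
  by move/eqP; exact/negP.
have cd : continuous (fun z : G * G => z.1 * z.2^-1).
  move=> z; apply: (@continuous2_cvg _ _ _ _ _ _ (fun z : G * G => z.1)
      (fun z : G * G => z.2^-1) (fun a b : G => a * b) z.1 z.2^-1).
  - exact: (@mulg_continuous G (z.1, z.2^-1)).
  - exact: cvg_fst.
  - apply: (@continuous_comp _ _ _ snd (fun a : G => a^-1)); first exact: cvg_snd.
    exact: invg_continuous.
have nN : nbhs (1 * 1^-1 : G) (~` [set x^-1 * y]) by exact: open_nbhs_nbhs.
have [[A B] /= [nA nB] AB] := cd (1, 1) _ nN.
rewrite nbhsE in nA; rewrite nbhsE in nB.
have [A' [oA' A'1] A'A] := nA; have [B' [oB' B'1] B'B] := nB.
have oT g (C : set G) : open C -> open [set z | C (g^-1 * z)].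
  by move=> oC; apply: open_comp => // z _; exact: lmulg_continuous.
exists ([set z | A' (x^-1 * z)], [set z | B' (y^-1 * z)]).
  by split=> /=; rewrite inE /= mulVg.
split => /=; [exact: oT|exact: oT|].
apply/eqP; rewrite -subset0 => z /= [/A'A Az /B'B Bz].
apply: (AB (x^-1 * z, y^-1 * z) (conj Az Bz)) => /=.
by rewrite invgM invgK mulgA mulgK.
Qed.

Section LocallyNormal.
Variable G : tdlcGroupType.
Implicit Types K L : set G.

Definition locally_normal : set (set G) :=
  [set K | [/\ subgroup K, compact K & open (normaliser K)]].

Lemma locally_normal1 : locally_normal [set 1].
Proof.
have sg1 : subgroup [set 1 : G].
  by apply/subgroupP; split => // x y /= -> ->; rewrite mulgV.
split => //; first exact: compact_set1.
rewrite (_ : normaliser _ = setT); first exact: openT.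
apply/seteqP; split=> // g _; apply/seteqP; split=> x.
  by move=> [y -> <-]; rewrite mulg1 mulgV.
by move=> ->; exists 1 => //; rewrite mulg1 mulgV.
Qed.

Lemma locally_normalI K L :
  locally_normal K -> locally_normal L -> locally_normal (K `&` L).
Proof.
move=> [sK cK oK] [sL cL oL]; split; first exact: subgroupI.
- apply: (subclosed_compact _ cK); last by move=> x [].
  by apply: closedI; apply: compact_closed => //; exact: tdlc_hausdorff.
- apply: (@subgroup_open _ _ (normaliser K `&` normaliser L)).
  + exact: normaliser_subgroup.
  + exact: openI.
  + by split; apply: subgroup1; exact: normaliser_subgroup.
  + by move=> g [NK NL]; rewrite /normaliser/= conjsetI NK NL.
Qed.

Lemma locally_normalJ (g : G) K : locally_normal K -> locally_normal (conjset g K).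
Proof.
move=> [sK cK oK]; split; first exact: conjset_subgroup.
- exact: conjset_compact.
- by rewrite normaliserJ; exact: conjset_open.
Qed.

Lemma locally_normal_subgroup (K : locally_normal) : subgroup (val K).
Proof. by have := valP K; rewrite inE => -[]. Qed.

Definition ln1 : locally_normal := SigSub (mem_set locally_normal1).

Definition lnI (K L : locally_normal) : locally_normal :=
  SigSub (mem_set (locally_normalI (set_mem (valP K)) (set_mem (valP L)))).

Definition lnJ (g : G) (K : locally_normal) : locally_normal :=
  SigSub (mem_set (locally_normalJ g (set_mem (valP K)))).

Definition comm_rel : rel locally_normal :=
  fun K L : locally_normal => `[< commensurable (val K) (val L) >].

Lemma comm_rel_refl : reflexive comm_rel.
Proof.
move=> K; apply/asboolP/commensurableE.
by split; apply: virtually_subxx => //; exact: locally_normal_subgroup.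
Qed.

Lemma comm_rel_sym : symmetric comm_rel.
Proof.
by move=> K L; apply/asboolP/asboolP => /commensurableE[? ?];
  apply/commensurableE.
Qed.

Lemma comm_rel_trans : transitive comm_rel.
Proof.
move=> L K M /asboolP/commensurableE[KL LK] /asboolP/commensurableE[LM ML].
have s := locally_normal_subgroup.
apply/asboolP/commensurableE; split.
- exact: virtually_sub_trans KL LM.
- exact: virtually_sub_trans ML LK.
Qed.

Canonical comm_equiv := EquivRel comm_rel
  comm_rel_refl comm_rel_sym comm_rel_trans.

End LocallyNormal.
Arguments locally_normal G : clear implicits.

(* The structure lattice; the class [K] is written \pi_(LN G) K. *)
Definition LN (G : tdlcGroupType) : Type := {eq_quot @comm_equiv G}%qT.
HB.instance Definition _ (G : tdlcGroupType) := Choice.on (LN G).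
HB.instance Definition _ (G : tdlcGroupType) := EqQuotient.on (LN G).

Fact LN_display : Order.disp_t. Proof. exact: Order.Disp tt tt. Qed.

Section StructureLattice.
Variable G : tdlcGroupType.
Local Open Scope quotient_scope.
Implicit Types (a b c : LN G) (K L : locally_normal G).

Let s := @locally_normal_subgroup G.

Lemma piLN_eq K L :
  \pi_(LN G) K = \pi_(LN G) L <-> commensurable (val K) (val L).
Proof.
split=> [/eqP|KL]; first by rewrite eqmodE => /asboolP.
by apply/eqP; rewrite eqmodE; exact/asboolP.
Qed.

Definition LN_le a b : bool := `[< virtually_sub (val (repr a)) (val (repr b)) >].

(* The greatest lower bound for the order on LN, by the instances below; on
   classes it is [LN_meetPi]. *)
Definition LN_meet a b : LN G := \pi_(LN G) (lnI (repr a) (repr b)).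

(* g.[K] = [g K g^-1], see [LN_conjPi]. *)
Definition LN_conj (g : G) a : LN G := \pi_(LN G) (lnJ g (repr a)).

Lemma reprLN K : commensurable (val (repr (\pi_(LN G) K))) (val K).
Proof. by apply/piLN_eq; rewrite reprK. Qed.

Lemma LN_lePi K L :
  LN_le (\pi_(LN G) K) (\pi_(LN G) L) <-> virtually_sub (val K) (val L).
Proof.
have /commensurableE[K1 K2] := reprLN K; have /commensurableE[L1 L2] := reprLN L.
split=> [/asboolP KL|KL].
- apply: (virtually_sub_trans (s _) (s _) (s _) K2).
  exact: (virtually_sub_trans (s _) (s _) (s _) KL).
- apply/asboolP; apply: (virtually_sub_trans (s _) (s _) (s _) K1).
  exact: (virtually_sub_trans (s _) (s _) (s _) KL).
Qed.

Lemma LN_le_refl : reflexive LN_le.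
Proof. by move=> a; apply/asboolP; apply: virtually_subxx => //; exact: s. Qed.

Lemma LN_le_anti : antisymmetric LN_le.
Proof.
move=> a b /andP[/asboolP ab /asboolP ba].
by rewrite -[a]reprK -[b]reprK; apply/piLN_eq/commensurableE.
Qed.

Lemma LN_le_trans : transitive LN_le.
Proof.
move=> b a c /asboolP ab /asboolP bc; apply/asboolP.
exact: (virtually_sub_trans (s _) (s _) (s _) ab bc).
Qed.

HB.instance Definition _ :=
  @Order.Le_isPOrder.Build LN_display (LN G) LN_le
    LN_le_refl LN_le_anti LN_le_trans.

Lemma LN_lexI a b c : LN_le a (LN_meet b c) = LN_le a b && LN_le a c.
Proof.
rewrite -{1}[a]reprK; apply/idP/andP.
- move=> /LN_lePi/(virtually_subI (s _) (s _) (s _))[ab ac].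
  by split; exact/asboolP.
- move=> [/asboolP ab /asboolP ac]; apply/LN_lePi.
  exact/(virtually_subI (s _) (s _) (s _)).
Qed.

HB.instance Definition _ :=
  @Order.POrder_isMeetSemilattice.Build LN_display (LN G) LN_meet LN_lexI.

Lemma LN_le0x a : LN_le (\pi_(LN G) (ln1 G)) a.
Proof.
rewrite -[a]reprK; apply/LN_lePi/virtually_subxx; [exact: s|exact: s|].
by move=> x /= ->; apply: subgroup1; exact: s.
Qed.

HB.instance Definition _ :=
  @Order.hasBottom.Build LN_display (LN G) (\pi_(LN G) (ln1 G)) LN_le0x.

Lemma LN_meetPi K L :
  Order.meet (\pi_(LN G) K) (\pi_(LN G) L) = \pi_(LN G) (lnI K L).
Proof.
apply/le_anti/andP; split.
- rewrite -[X in (X <= _)%O]reprK; apply/LN_lePi/virtually_subI; [exact: s|exact: s|exact: s|].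
  split; apply/LN_lePi; rewrite reprK.
  + exact: (leIl (\pi_(LN G) K) (\pi_(LN G) L)).
  + exact: (leIr (\pi_(LN G) L) (\pi_(LN G) K)).
- by rewrite lexI; apply/andP; split; apply/LN_lePi; apply: virtually_subxx;
    (try exact: s) => x [].
Qed.

Lemma LN_conjPi g K : LN_conj g (\pi_(LN G) K) = \pi_(LN G) (lnJ g K).
Proof.
have /commensurableE[K1 K2] := reprLN K.
apply/piLN_eq/commensurableE.
by split; apply: virtually_subJ => //; exact: s.
Qed.

End StructureLattice.

Section CentraliserLattice.
Variable G : tdlcGroupType.
Local Open Scope quotient_scope.
Implicit Types (a b : LN G).

(* [b] is a possible value of a^\perp: the class of C_U(K) for some
   representative K of a that is closed and normal in a compact open
   subgroup U. *)
Definition is_perp a b : Prop :=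
  exists (K C : locally_normal G) (U : set G),
    [/\ a = \pi_(LN G) K,
        [/\ subgroup U, compact U & open U],
        [/\ closed (val K), val K `<=` U & U `<=` normaliser (val K)],
        val C = centraliser_in U (val K)
      & b = \pi_(LN G) C].

(* A choice of K and U.  Such K and U always exist by van Dantzig's theorem, and
   C_U(K) is locally normal, being closed in U and normalised by U; so the
   default value \bot is never used. *)
Definition perp a : LN G := xget \bot%O [set b | is_perp a b].

Definition LC : set (LN G) := range perp.

Definition perp_join a b : LN G := perp (Order.meet (perp a) (perp b)).

End CentraliserLattice.
Arguments LC G : clear implicits.

(* The operations of [L] restricted to the subset [S] make [S] a Boolean
   lattice; in particular [S] is closed under them. *)
Definition is_boolean_lattice_on (L : Type) (S : set L)
    (join meet : L -> L -> L) (compl : L -> L) : Prop :=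
  exists (d : Order.disp_t) (c : Order.CTBDistrLattice.axioms_ d S),
  let B := Order.CTBDistrLattice.Pack c in
  [/\ forall x y : B, val (Order.join x y : S) = join (val (x : S)) (val (y : S)),
      forall x y : B, val (Order.meet x y : S) = meet (val (x : S)) (val (y : S))
    & forall x : B, val (Order.compl x : S) = compl (val (x : S))].

Definition acts_by_automorphisms_on (G : groupType) (L : Type) (S : set L)
    (join meet : L -> L -> L) (compl : L -> L) (act : G -> L -> L) : Prop :=
  [/\ forall x, S x -> act 1 x = x,
      forall g h x, S x -> act (g * h) x = act g (act h x)
    & forall g, [/\ set_bij S S (act g),
        forall x y, S x -> S y -> act g (join x y) = join (act g x) (act g y),
        forall x y, S x -> S y -> act g (meet x y) = meet (act g x) (act g y)
      & forall x, S x -> act g (compl x) = compl (act g x)]].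

Section ClassS.
Variable G : tdlcGroupType.

Definition compactly_generated : Prop :=
  exists2 C : set G, compact C &
    forall H : set G, subgroup H -> C `<=` H -> H = setT.

Definition topologically_simple : Prop :=
  [set: G] <> [set 1] /\
  forall N : set G, subgroup N -> closed N -> normaliser N = setT ->
    N = [set 1] \/ N = setT.

Definition non_discrete : Prop := ~ forall A : set G, open A.

Definition in_class_S : Prop :=
  [/\ compactly_generated, topologically_simple & non_discrete].

End ClassS.

(* Main.v *)
(** Let [A] be an abelian locally normal subgroup of [G], and suppose that it is
    not trivial.  Compact generation and simplicity give finitely many
    conjugates [A_1], ..., [A_n] of [A], permuted by a proper compact open
    subgroup [U] and generating [G] together with [U].  The set [Q] of the
    elements that centralise every [A_i `&` W], for some neighbourhood [W] of
    [1], is normalised by [U]; it is also normalised by each [A_i], because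
    commutators of [A_i] with elements close to [1] are elements of [A_i] close
    to [1].  So [Q] is normal in [G], and iterated commutators show that it is
    not trivial.  Hence [G] is generated by [U] and finitely many elements of
    [Q], which centralise the [A_i `&` W] for a common [W], and by simplicity
    [A_i `&` W] is trivial for [W] small.  So [A_i] is discrete and lies in the
    quasi-centre (the elements with open centraliser), which is trivial by the
    same argument with [Q] the quasi-centre.

    As finite and abelian locally normal subgroups are trivial, [perp a] is the
    pseudocomplement of [a], and the pseudocomplements of a meet-semilattice
    with bottom form a Boolean lattice (Glivenko, Frink). *)
Require Import Defs.
From HB Require Import structures.
From mathcomp Require Import all_boot all_order all_classical topology.

Set Implicit Arguments.
Unset Strict Implicit.
Unset Printing Implicit Defensive.
Import Order.TTheory.
Local Open Scope classical_set_scope.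
Local Open Scope group_scope.

(** * Compact open neighbourhoods *)

(** The quasicomponent of [x] in a compact neighbourhood [M] is connected, hence reduced to [x]. By
    compactness some relatively clopen subset of [M] then lies in [O] and in the interior of [M],
    and such a set is open. *)
Lemma compact_open_nbhs (T : topologicalType) (K : set T) (x : T) :
  hausdorff_space T -> compact K -> nbhs x K ->
  connected_component setT x = [set x] ->
  forall O, nbhs x O -> exists C, [/\ compact C, open C, C x & C `<=` O].
Proof.
move=> hT cK nK cx O nO.
have [L nL LK] := compact_regular hT cK nK (nbhs_interior nK).
set M := closure L.
have clM : closed M := @closed_closure _ L.
have cM : compact M.
  by apply: (subclosed_compact clM cK) => y /LK; exact: interior_subset.
have Mx : M x by apply: subset_closure; exact: nbhs_singleton.
pose F := [set D : set T | [/\ D `<=` M, D x, closed D & closed (M `\` D)]].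
have FM : F M by split => //; rewrite setDv; exact: closed0.
have FI D D' : F D -> F D' -> F (D `&` D').
  move=> [DM Dx cD cD'] [D'M D'x cE cE']; split => //.
  - by move=> y [/DM].
  - exact: closedI.
  - by rewrite setDIr; exact: closedU.
(* [E] is the quasicomponent of [x] in [M]; it is connected by compactness. *)
pose E := [set y | forall D, F D -> D y].
have EM : E `<=` M by move=> y /(_ _ FM).
have clE : closed E.
  have -> : E = \bigcap_(D in F) D by [].
  by apply: closed_bigI => D [].
(* If no member of [F] fits into [P], the parts of the members outside [P] generate a proper filter;
   by compactness it clusters at a point outside [P] that lies in every member, hence in [E]. *)
have small (P : set T) : open P -> E `<=` P -> exists2 D, F D & D `<=` P.
  move=> oP EP; apply: contrapT => nD.
  have FF : ProperFilter (filter_from F (fun D => D `\` P)).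
    apply: filter_from_proper; last first.
      move=> D FD; apply: contrapT => DP; apply: nD; exists D => // y Dy.
      by apply: contrapT => Py; apply: DP; exists y.
    apply: filter_from_filter; first by exists M.
    move=> D D' FD FD'; exists (D `&` D'); first exact: FI.
    by move=> y [[? ?] ?].
  have cMP : compact (M `\` P).
    apply: (subclosed_compact _ cM); last by move=> y [].
    by rewrite setDE; apply: closedI => //; exact: open_closedC.
  have [|p [[Mp Pp] clp]] := cMP _ FF; first by exists M.
  apply: Pp; apply: EP => D FD; have [_ _ cD _] := FD.
  apply: cD => A nA; have : filter_from F (fun D => D `\` P) (D `\` P) by exists D.
  by move=> /clp/(_ nA)[y [[Dy _] Ay]]; exists y.
have Ex : E x by move=> D [].
have cE : connected E.
  (* Of a relatively clopen subset of [E] and its complement, one contains [x]; it suffices that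
     this one is all of [E]. *)
  suff H (B : set T) : B x -> closed B -> closed (E `\` B) -> E `<=` B.
    move=> B [b Bb] [C oC BC] [C' cC' BC'].
    have EB : E `\` B = E `&` ~` C.
      rewrite BC; apply/seteqP; split=> y [Ey H1]; split=> //.
        by move=> Cy; apply: H1.
      by move=> [_ /H1].
    have [Bx|nBx] := pselect (B x).
      apply/seteqP; split; first by rewrite BC => y [].
      apply: H => //; first by rewrite BC'; exact: closedI.
      by rewrite EB; apply: closedI => //; exact: open_closedC.
    have /(_ b) [] : E `<=` E `\` B.
      apply: H => //; first by rewrite EB; apply: closedI => //; exact: open_closedC.
      rewrite setDD BC' setIA setIid; exact: closedI.
    - by move: Bb; rewrite BC => -[].
    - by [].
  move=> Bx cB cEB.
  have BK : E `&` B `<=` K° by move=> y [/EM/LK].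
  have nB : set_nbhs (E `&` B) (~` (E `\` B)).
    apply/set_nbhsP; exists (~` (E `\` B)); split => //; first exact: closed_openC.
    by move=> y [Ey By] [].
  have [N /set_nbhsP[P [oP BP PN]] NB] :=
    compact_normal_local hT cK BK (closedI clE cB) nB.
  have EP : E `<=` P `|` ~` closure N.
    move=> y Ey; have [By|nBy] := pselect (B y); first by left; apply: BP.
    by right => /NB; apply.
  have [|D FD DP] := small _ _ EP.
    by apply: openU => //; apply: closed_openC; exact: closed_closure.
  have [DM Dx cD cMD] := FD.
  (* On [D] the open set [P] and the closed set [closure N] coincide, so their trace stays
     relatively clopen in [M]. *)
  have FN : F (D `&` closure N).
    split.
    - by move=> y [/DM].
    - by split => //; apply/subset_closure/PN/BP.
    - by apply: closedI => //; exact: closed_closure.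
    - have -> : M `\` (D `&` closure N) = (M `\` D) `|` (M `&` ~` P).
        apply/seteqP; split=> y.
          move=> [My nDN]; have [Dy|nDy] := pselect (D y); last by left.
          right; split => // Py; apply: nDN; split => //.
          exact/subset_closure/PN.
        move=> [[My nDy]|[My nPy]]; split => //; first by move=> [].
        by move=> [Dy Ny]; case: (DP _ Dy).
      by apply: closedU => //; apply: closedI => //; exact: open_closedC.
  move=> y Ey; apply: contrapT => nBy.
  by have [_ /NB] := Ey _ FN; apply.
have E1 : E `<=` [set x] by rewrite -cx; exact: connected_component_max.
have [||D FD DO] := small (L° `&` O°).
- by apply: openI; exact: open_interior.
- by move=> y /E1 ->; split; apply: nbhs_singleton; exact: nbhs_interior.
have [DM Dx cD cMD] := FD.
exists D; split => //.
- exact: (subclosed_compact cD cM).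
- have -> : D = (L° `&` O°) `&` ~` (M `\` D).
    apply/seteqP; split=> y.
      by move=> Dy; split; [exact: DO|move=> []].
    move=> [[/interior_subset/subset_closure My _] nMD].
    by apply: contrapT => nDy; exact: nMD.
  apply: openI; last exact: closed_openC.
  by apply: openI; exact: open_interior.
- by move=> y /DO[_ /interior_subset].
Qed.

Lemma filter_bigcap_finite (I : choiceType) (T : Type) (F : set_system T)
    (D : set I) (f : I -> set T) {FF : Filter F} : finite_set D ->
  (forall i, D i -> F (f i)) -> F (\bigcap_(i in D) f i).
Proof.
move=> /finite_fsetP[X ->] Ff; exact: filter_bigI.
Qed.

(** * Subgroups, topological groups and van Dantzig's theorem *)

Section GroupTheory.
Variable G : groupType.
Implicit Types (g x y : G) (A B H K L Q U W : set G).

Definition generated A : set G :=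
  [set x | forall H, subgroup H -> A `<=` H -> H x].

Lemma generated_subgroup A : subgroup (generated A).
Proof.
apply/subgroupP; split; first by move=> H sH _; exact: subgroup1.
move=> x y Ax Ay H sH AH; apply: subgroupM => //; first exact: Ax.
by apply: subgroupV => //; exact: Ay.
Qed.

Lemma sub_generated A : A `<=` generated A.
Proof. by move=> x Ax H _; apply. Qed.

Lemma generatedS A B : A `<=` B -> generated A `<=` generated B.
Proof. by move=> AB x Ax H sH /(subset_trans AB); exact: Ax. Qed.

Lemma sub_normaliser H Q : subgroup H ->
  (forall h x, H h -> Q x -> Q (h * x * h^-1)) -> H `<=` normaliser Q.
Proof.
move=> sH HQ h Hh; apply/seteqP; split=> x.
  by move=> [y Qy <-]; exact: HQ.
move=> Qx; apply/conjsetP; rewrite -[X in _ * _ * X]invgK.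
by apply: HQ => //; exact: subgroupV.
Qed.

Lemma normaliserP K g x : normaliser K g -> K x -> K (g * x * g^-1).
Proof. by move=> NK Kx; rewrite -[K]NK; exists x. Qed.

Lemma normaliserVP K g x : normaliser K g -> K x -> K (g^-1 * x * g).
Proof. by move=> NK Kx; apply/conjsetP; rewrite NK. Qed.

Lemma commuteJ g x y : commute x y -> commute (g * x * g^-1) (g * y * g^-1).
Proof.
by move=> xy; rewrite /commute !mulgA !mulgVK -!(mulgA g) xy.
Qed.

Lemma commutator_eq1 x y : x * y * x^-1 * y^-1 = 1 -> commute x y.
Proof. by move=> /divg1_eq E; rewrite /commute -{2}E mulgVK. Qed.

(** The commutator is [x] times a conjugate of [x^-1], and also a conjugate of [y] times [y^-1].
    When [K] and [L] meet trivially, [x] and [y] therefore commute. *)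
Lemma commutator_normal K L x y : subgroup K -> subgroup L -> K x -> L y ->
  normaliser K y -> normaliser L x -> (K `&` L) (x * y * x^-1 * y^-1).
Proof.
move=> sK sL Kx Ly Ny Nx; split.
  rewrite -!mulgA; apply: (subgroupM sK) => //; rewrite mulgA.
  by apply: normaliserP => //; exact: subgroupV.
apply: (subgroupM sL); last exact: subgroupV.
exact: normaliserP.
Qed.

Lemma centraliser_subgroup U K : subgroup U -> subgroup (centraliser_in U K).
Proof.
move=> sU; apply/subgroupP; split.
  split; first exact: subgroup1.
  by move=> k _; exact/commute_sym/commute1.
move=> x y [Ux xK] [Uy yK]; split.
  by apply: subgroupM => //; exact: subgroupV.
by move=> k Kk; apply: commute_sym; apply: commuteM; last apply: commuteV;
  apply: commute_sym; [exact: xK|exact: yK].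
Qed.

Lemma normaliser_centraliser U K : subgroup U -> U `<=` normaliser K ->
  U `<=` normaliser (centraliser_in U K).
Proof.
move=> sU UK; apply: sub_normaliser => // u x Uu [Ux xK]; split.
  by apply: subgroupM; [|exact: subgroupM|exact: subgroupV].
move=> k Kk; have -> : k = u * (u^-1 * k * u) * u^-1.
  by rewrite !mulgA mulgV mul1g mulgK.
by apply: commuteJ; apply: xK; apply: normaliserVP => //; exact: UK.
Qed.

(** For subgroups this is the normal core in [U] of the intersection of [U] and [W]; [W] will also
    be a mere neighbourhood of [1]. *)
Definition core U W : set G :=
  [set y | U y /\ forall u, U u -> W (u^-1 * y * u)].

Lemma core_subgroup U W : subgroup U -> subgroup W -> subgroup (core U W).
Proof.
move=> sU sW; apply/subgroupP; split.
  split; first exact: subgroup1.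
  by move=> u _; rewrite mulg1 mulVg; exact: subgroup1.
move=> x y [Ux Wx] [Uy Wy]; split.
  by apply: subgroupM => //; exact: subgroupV.
move=> u Uu.
have -> : u^-1 * (x * y^-1) * u = (u^-1 * x * u) * (u^-1 * y * u)^-1.
  by rewrite !invgM invgK !mulgA mulgK.
by apply: (subgroupM sW); [exact: Wx|apply: (subgroupV sW); exact: Wy].
Qed.

Lemma core_normaliser U W : subgroup U -> U `<=` normaliser (core U W).
Proof.
move=> sU; apply: sub_normaliser => // u x Uu [Ux Wx]; split.
  by apply: subgroupM; [|exact: subgroupM|exact: subgroupV].
move=> v Uv.
have -> : v^-1 * (u * x * u^-1) * v = (u^-1 * v)^-1 * x * (u^-1 * v).
  by rewrite invgM invgK !mulgA.
by apply: Wx; apply: subgroupM => //; exact: subgroupV.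
Qed.

Lemma core_sub U W : subgroup U -> core U W `<=` W.
Proof.
by move=> sU x [_ /(_ 1 (subgroup1 sU))]; rewrite invg1 mul1g mulg1.
Qed.

End GroupTheory.

(** If [P A] failed, the sets whose complement in [A] satisfies [P] would form a proper filter, and
    a cluster point of it would contradict the local hypothesis. *)
Lemma compact_ind (T : topologicalType) (A : set T) (P : set T -> Prop) :
  compact A -> P set0 -> (forall B C, B `<=` C -> P C -> P B) ->
  (forall B C, P B -> P C -> P (B `|` C)) ->
  (forall x, A x -> exists2 N, nbhs x N & P N) -> P A.
Proof.
move=> cA P0 PS PU PN; apply: contrapT => nPA.
pose F : set_system T := [set S | P (A `\` S)].
have FF : ProperFilter F.
  split; first by rewrite /F /= setD0.
  split; first by rewrite /F /= setDT.
  - by move=> B C FB FC; rewrite /F /= setDIr; exact: PU.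
  - by move=> B C BC; apply: PS => x [Ax nCx]; split => // /BC.
have [|x [Ax clx]] := cA F FF; first by rewrite /F /= setDv.
have [N nN PNx] := PN x Ax.
have FN : F (~` N) by apply: PS PNx => y [_ /contrapT].
by have [y []] := clx _ _ FN nN.
Qed.

Section TopologicalGroupTheory.
Variable G : topologicalGroupType.
Implicit Types (g x y : G) (H K L U W : set G).

Lemma cvgMg (I : Type) (F : set_system I) (FF : Filter F) (f g : I -> G) a b :
  f @ F --> a -> g @ F --> b -> (fun i => f i * g i) @ F --> a * b.
Proof.
move=> fa gb; apply: (@continuous2_cvg _ _ _ _ _ _ f g (fun a b : G => a * b)) => //.
exact: (@mulg_continuous G (a, b)).
Qed.

Lemma cvgVg (I : Type) (F : set_system I) (FF : Filter F) (f : I -> G) a :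
  f @ F --> a -> (fun i => (f i)^-1) @ F --> a^-1.
Proof.
move=> fa; apply: (@continuous_cvg _ _ _ F _ f (fun a : G => a^-1) a) => //.
exact: invg_continuous.
Qed.

Lemma subgroup_nbhs_open K : subgroup K -> nbhs 1 K -> open K.
Proof.
move=> sK; rewrite nbhsE => -[L [oL L1] LK]; exact: subgroup_open oL L1 LK.
Qed.

Lemma open_subgroup_nbhs K : subgroup K -> open K -> nbhs 1 K.
Proof. by move=> sK oK; apply: open_nbhs_nbhs; split => //; exact: subgroup1. Qed.

Lemma nbhs_lcoset g K : nbhs 1 K -> nbhs g (lcoset g K).
Proof.
move=> nK; apply: (@filterS _ _ _ ((fun x => g^-1 * x) @^-1` K)).
  by move=> x Kx; exact/lcosetP.
by apply: (@lmulg_continuous G g^-1 g); rewrite mulVg.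
Qed.

Lemma open_subgroup_closed H : subgroup H -> open H -> closed H.
Proof.
move=> sH oH x clx.
have [y [Hy /lcosetP Hxy]] := clx _ (nbhs_lcoset x (open_subgroup_nbhs sH oH)).
have -> : x = y * (x^-1 * y)^-1 by rewrite invgM invgK mulVKg.
by apply: subgroupM => //; exact: subgroupV.
Qed.

Lemma conjset_closed g K : closed K -> closed (conjset g K).
Proof.
move=> cK; have -> : conjset g K = (fun x => g^-1 * x * g^-1^-1) @^-1` K.
  by apply/seteqP; split=> x; rewrite conjsetP /= invgK.
by apply: preimage_closed => // x _; exact: conjg_continuous.
Qed.

Lemma nbhs1_conj g W : nbhs 1 W -> nbhs 1 [set y : G | W (g * y * g^-1)].
Proof.
move=> nW; have c1 : (fun y => g * y * g^-1) @ (1 : G) --> g * 1 * g^-1 :=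
  @conjg_continuous G g 1.
by rewrite mulg1 mulgV in c1; exact: c1.
Qed.

(** Tube lemma: conjugation is jointly continuous and fixes [1], so by compactness one neighbourhood
    of [1] works for all [u] in [U]. *)
Lemma nbhs_core U W : compact U -> nbhs 1 U -> nbhs 1 W -> nbhs 1 (core U W).
Proof.
move=> /compact_near_coveringP cU nU nW; apply: filterI => //.
apply: (cU _ (nbhs (1 : G)) (fun y u => W (u^-1 * y * u))) => u Uu.
have cvg1 : (fun z : G * G => z.1^-1 * z.2 * z.1) @ (u, 1 : G) --> u^-1 * 1 * u.
  apply: cvgMg; last exact: cvg_fst.
  apply: cvgMg; last exact: cvg_snd.
  by apply: cvgVg; exact: cvg_fst.
by apply: cvg1; rewrite mulg1 mulVg.
Qed.

(** Finitely many cosets of the open subgroup [W] cover the compact set [U]. *)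
Lemma compact_virtually_open U W : subgroup U -> compact U ->
  subgroup W -> open W -> virtually_sub U W.
Proof.
move=> sU cU sW oW; apply/virtually_subP => //.
pose P S := exists2 F : set G,
  finite_set F & forall x, S x -> exists2 f, F f & W (f^-1 * x).
apply: (compact_ind (P := P)) => //.
- by exists set0.
- by move=> B C BC [F fF FC]; exists F => // x /BC/FC.
- move=> B C [F fF FB] [E fE EC]; exists (F `|` E).
    by rewrite finite_setU.
  move=> x [/FB[f Ff Wf]|/EC[f Ef Wf]]; exists f => //; [by left|by right].
- move=> x _; exists (lcoset x W).
    by apply: nbhs_lcoset; exact: open_subgroup_nbhs.
  by exists [set x] => // y /lcosetP; exists x.
Qed.

(* The elements fixing a compact open neighbourhood [V] of [1] under right
   translation form an open subgroup of [V]. *)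
Lemma compact_open_subgroup (V : set G) : compact V -> open V -> V 1 ->
  exists U, [/\ subgroup U, open U & U `<=` V].
Proof.
move=> cV oV V1.
pose U := [set g | forall v, V v -> V (v * g) /\ V (v * g^-1)].
have sU : subgroup U.
  apply/subgroupP; split; first by move=> v; rewrite invg1 mulg1.
  move=> x y Ux Uy v Vv; split; rewrite ?invgM ?invgK mulgA.
    by apply: (Uy _ _).2; apply: (Ux _ _).1.
  by apply: (Ux _ _).2; apply: (Uy _ _).1.
exists U; split => //; last by move=> g /(_ _ V1)[]; rewrite mul1g.
apply: subgroup_nbhs_open => //.
have /compact_near_coveringP near_cov := cV.
apply: (near_cov _ (nbhs (1 : G)) (fun g v => V (v * g) /\ V (v * g^-1))) => v Vv.
have nV : nbhs v V by exact: open_nbhs_nbhs.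
have c1 : (fun z : G * G => z.1 * z.2) @ (v, 1 : G) --> v * 1.
  by apply: cvgMg; [exact: cvg_fst|exact: cvg_snd].
have c2 : (fun z : G * G => z.1 * z.2^-1) @ (v, 1 : G) --> v * 1^-1.
  by apply: cvgMg; [exact: cvg_fst|apply: cvgVg; exact: cvg_snd].
apply: (@filterI _ (nbhs (v, 1 : G))).
  by apply: c1; rewrite mulg1.
by apply: c2; rewrite invg1 mulg1.
Qed.

End TopologicalGroupTheory.

Section TDLCTheory.
Variable G : tdlcGroupType.
Implicit Types (g x y : G) (A B H K L U W : set G).

Lemma van_dantzig W : nbhs 1 W ->
  exists U, [/\ subgroup U, compact U, open U & U `<=` W].
Proof.
move=> nW; have [K wK [cK _]] := @tdlc_locally_compact G 1 I.
have nK : nbhs 1 K by apply: (@filterS _ (nbhs (1 : G)) _ _ _ _ wK) => y; apply.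
have [V [cV oV V1 VW]] := compact_open_nbhs (@tdlc_hausdorff G) cK nK
  (@tdlc_totally_disconnected G 1 I) nW.
have [U [sU oU UV]] := compact_open_subgroup cV oV V1.
exists U; split => //; last exact: subset_trans VW.
by apply: (subclosed_compact _ cV UV); exact: open_subgroup_closed.
Qed.

Lemma closed_set1g x : closed [set x].
Proof.
by apply: compact_closed; [exact: tdlc_hausdorff|exact: compact_set1].
Qed.

Lemma closed_commute x : closed [set y | commute y x].
Proof.
have -> : [set y | commute y x] = (fun y => y * x * y^-1) @^-1` [set x].
  apply/seteqP; split=> y; rewrite /commute /=; first by move=> ->; rewrite mulgK.
  by move=> E; rewrite -{2}E mulgVK.
apply: preimage_closed; last exact: closed_set1g.
move=> y _; apply: cvgMg; last by apply: cvgVg; exact: cvg_id.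
by apply: cvgMg; [exact: cvg_id|exact: cvg_cst].
Qed.

Lemma closed_centraliser U K : closed U -> closed (centraliser_in U K).
Proof.
move=> cU.
have -> : centraliser_in U K = U `&` \bigcap_(k in K) [set x | commute x k] by [].
by apply: closedI => //; apply: closed_bigI => k _; exact: closed_commute.
Qed.

Lemma nbhsgS g A B : A `<=` B -> nbhs g A -> nbhs g B.
Proof. by move=> AB; exact: filterS. Qed.

Lemma nbhsgI g A B : nbhs g A -> nbhs g B -> nbhs g (A `&` B).
Proof. exact: filterI. Qed.

End TDLCTheory.

(** * Abelian locally normal subgroups *)

Section ClassSTheory.
Variable G : tdlcGroupType.
Hypothesis hG : in_class_S G.
Implicit Types (g x y : G) (A B F H K L M N Q S U V W : set G).

Lemma simple_normal N : subgroup N -> closed N -> normaliser N = setT ->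
  N = [set 1] \/ N = setT.
Proof. by have [_ [_ simpleG] _] := hG; exact: simpleG. Qed.

(** The closed subgroup [N] generated by [S] is normal and not trivial, hence equal to [G]. The
    directed union [T] of the groups generated by [U] and finite subsets of [S] is open, hence
    closed, so it contains [N]. By compactness a single one of these open groups contains the
    compact generating set. *)
Lemma finite_generation U S x0 : subgroup U -> open U ->
  (forall g x, S x -> S (g * x * g^-1)) -> S x0 -> x0 <> 1 ->
  exists F, [/\ finite_set F, F `<=` S &
    forall H, subgroup H -> U `<=` H -> F `<=` H -> H = setT].
Proof.
move=> sU oU SJ Sx0 x0n1; have [[C cC genC] _ _] := hG.
pose T := [set x | exists F, [/\ finite_set F, F `<=` S & generated (U `|` F) x]].
have sT : subgroup T.
  apply/subgroupP; split.
    by exists set0; split => //; exact: subgroup1 (generated_subgroup _).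
  move=> x y [F [fF FS Fx]] [E [fE ES Ey]]; exists (F `|` E); split.
  - by rewrite finite_setU.
  - by move=> z [/FS|/ES].
  - apply: (subgroupM (generated_subgroup _)).
      by apply: generatedS Fx => z [?|?]; [left|right; left].
    apply: (subgroupV (generated_subgroup _)).
    by apply: generatedS Ey => z [?|?]; [left|right; right].
have gen_open F : open (generated (U `|` F)).
  apply: subgroup_nbhs_open; first exact: generated_subgroup.
  apply: (@filterS _ (nbhs (1 : G)) _ U); last exact: open_subgroup_nbhs.
  by move=> x Ux; apply: sub_generated; left.
have oT : open T.
  apply: subgroup_nbhs_open => //.
  apply: (@filterS _ (nbhs (1 : G)) _ U); last exact: open_subgroup_nbhs.
  by move=> x Ux; exists set0; split => //; apply: sub_generated; left.
have ST : S `<=` T.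
  move=> x Sx; exists [set x]; split=> //; first by move=> y ->.
  by apply: sub_generated; right.
pose N := [set x | forall H, subgroup H -> closed H -> S `<=` H -> H x].
have sN : subgroup N.
  apply/subgroupP; split; first by move=> H sH _ _; exact: subgroup1.
  move=> x y Nx Ny H sH cH SH; apply: subgroupM => //; first exact: Nx.
  by apply: subgroupV => //; exact: Ny.
have cN : closed N.
  have -> : N = \bigcap_(H in [set H | [/\ subgroup H, closed H & S `<=` H]]) H.
    apply/seteqP; split=> x; first by move=> Nx H [*]; exact: Nx.
    by move=> Nx H *; exact: Nx.
  by apply: closed_bigI => H [].
have NN : normaliser N = setT.
  apply/seteqP; split=> // g0 _; apply: (@sub_normaliser _ setT) => // [|g x _ Nx].
    by apply/subgroupP; split.
  move=> H sH cH SH.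
  suff : conjset g^-1 H x by move/conjsetP; rewrite invgK.
  apply: (Nx (conjset g^-1 H)); first exact: conjset_subgroup.
    exact: conjset_closed.
  by move=> y Sy; apply/conjsetP; rewrite invgK; apply: SH; exact: SJ.
have TT : T = setT.
  have TN : N `<=` T by move=> x; apply=> //; exact: open_subgroup_closed.
  case: (simple_normal sN cN NN) => EN.
    have : N x0 by move=> H _ _; apply.
    by rewrite EN.
  by apply/seteqP; split=> // x _; apply: TN; rewrite EN.
pose P B := exists F, [/\ finite_set F, F `<=` S & B `<=` generated (U `|` F)].
have [|B D BD [F [fF FS FD]]|B D [F [fF FS FB]] [E [fE ES ED]]|x _|F [fF FS CF]] :=
  @compact_ind G C P cC.
- by exists set0; split.
- by exists F; split => //; exact: subset_trans FD.
- exists (F `|` E); split.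
  + by rewrite finite_setU.
  + by move=> z [/FS|/ES].
  + move=> z [/FB|/ED]; apply: generatedS => t [?|?];
      [by left|by right; left|by left|by right; right].
- have : T x by rewrite TT.
  move=> [F [fF FS Fx]]; exists (generated (U `|` F)); last by exists F; split.
  by apply: open_nbhs_nbhs; split.
- exists F; split => // H sH UH FH; apply: genC => // x /CF/(_ H sH); apply.
  by move=> y [/UH|/FH].
Qed.

Lemma proper_compact_open_subgroup W : nbhs 1 W ->
  exists U, [/\ subgroup U, compact U, open U, U `<=` W & U <> setT].
Proof.
move=> nW; have [_ [nt _] _] := hG.
have [x x1] : exists x : G, x <> 1.
  apply: contrapT => nx; apply: nt; apply/seteqP; split=> // x _.
  by apply: contrapT => x1; apply: nx; exists x.
(* Leaving out a point [x] other than [1] forces the subgroup to be proper. *)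
have nx : nbhs 1 (W `&` ~` [set x]).
  apply: filterI => //; apply: open_nbhs_nbhs; split.
    by apply: closed_openC; exact: closed_set1g.
  by move=> /esym /x1.
have [U [sU cU oU UW]] := van_dantzig nx.
exists U; split => //; first by move=> y /UW[].
by move=> UT; have [_] : (W `&` ~` [set x]) x by [apply: UW; rewrite UT]; apply.
Qed.

(** Choose [F] generating [G] together with [U]. The core is normalised by [U] and centralised by
    [F], so it is a closed normal subgroup of [G]; it is proper because it lies in [U]. *)
Lemma finite_trivial_centraliser U Q x0 : subgroup U -> compact U -> open U ->
  U <> setT -> (forall g x, Q x -> Q (g * x * g^-1)) -> Q x0 -> x0 <> 1 ->
  exists F, [/\ finite_set F, F `<=` Q &
    core U (centraliser_in setT F) `<=` [set 1]].
Proof.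
move=> sU cU oU UT QJ Qx0 x01.
have [F [fF FQ genF]] := finite_generation sU oU QJ Qx0 x01.
exists F; split => //; set W := centraliser_in setT F.
have sW : subgroup W by apply: centraliser_subgroup; exact/subgroupP.
have sM := core_subgroup sU sW.
have cM : closed (core U W).
  have -> : core U W = U `&` \bigcap_(u in U) ((fun y => u^-1 * y * u) @^-1` W) by [].
  apply: closedI; first exact: open_subgroup_closed.
  apply: closed_bigI => u _; apply: preimage_closed; last first.
    exact/closed_centraliser/closedT.
  by move=> z _; have := @conjg_continuous G u^-1 z; rewrite invgK.
have NM : normaliser (core U W) = setT.
  apply: genF; [exact: normaliser_subgroup|exact: core_normaliser|].
  move=> q Fq.
  have cq z : core U W z -> commute z q by move=> /(core_sub sU)[_]; apply.
  apply/seteqP; split=> z.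
    by move=> [t Mt <-]; rewrite -(cq _ Mt) mulgK.
  by move=> Mz; exists z => //; rewrite -(cq _ Mz) mulgK.
case: (simple_normal sM cM NM) => [->//|EM].
by case: UT; apply/seteqP; split=> // z _; have [] : core U W z by rewrite EM.
Qed.

Lemma nbhs_commuteJ g x :
  nbhs 1 [set y | commute y x] -> nbhs 1 [set y | commute y (g * x * g^-1)].
Proof.
move=> nx; apply: nbhsgS (nbhs1_conj g^-1 nx) => y /= /(commuteJ g).
by rewrite invgK !mulgA mulgV mul1g mulgK.
Qed.

(** Otherwise finitely many quasi-central elements have a trivial core of their centraliser; but
    that centraliser and its core are neighbourhoods of [1], so [G] would be discrete. *)
Lemma quasicentre_trivial x : nbhs 1 [set y | commute y x] -> x = 1.
Proof.
move=> nx; apply: contrapT => x1.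
have [U [sU cU oU _ UT]] := proper_compact_open_subgroup (@filterT _ (nbhs (1 : G)) _).
have [F [fF FQ F1]] := finite_trivial_centraliser sU cU oU UT nbhs_commuteJ nx x1.
have nFQ : nbhs (1 : G) (centraliser_in setT F).
  have nF : nbhs (1 : G) (\bigcap_(q in F) [set y | commute y q]).
    exact: filter_bigcap_finite.
  by apply: nbhsgS nF => y yF; split.
have n11 : nbhs 1 [set 1 : G].
  by apply: nbhsgS F1 _; apply: nbhs_core => //; exact: open_subgroup_nbhs.
have [_ _] := hG; apply => A; rewrite openE => y Ay.
apply: nbhsgS (nbhs_lcoset y n11) => z /lcosetP /= yz.
by rewrite -[z](mulVKg y) yz mulg1.
Qed.

(** For [x] in [K] and [y] close to [1], the commutator of [y] and [x] lies in [K] and in [W], hence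
    is [1]. So [x] is quasi-central. *)
Lemma discrete_locally_normal_trivial K W : locally_normal G K ->
  nbhs 1 W -> K `&` W `<=` [set 1] -> K = [set 1].
Proof.
move=> [sK cK oN] nW KW; apply/seteqP; split=> x; last first.
  by move=> ->; exact: subgroup1.
move=> Kx; apply: quasicentre_trivial.
have c1 : (fun y => y * x * y^-1 * x^-1) @ (1 : G) --> 1 * x * 1^-1 * x^-1.
  apply: cvgMg; last exact: cvg_cst.
  apply: cvgMg; last by apply: cvgVg; exact: cvg_id.
  by apply: cvgMg; [exact: cvg_id|exact: cvg_cst].
rewrite invg1 mul1g mulg1 mulgV in c1.
have nN := open_subgroup_nbhs (normaliser_subgroup K) oN.
apply: nbhsgS (nbhsgI nN (c1 _ nW)) => y [Ny Wy].
have /KW : (K `&` W) (y * x * y^-1 * x^-1).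
  split => //; apply: subgroupM => //; first exact: normaliserP.
  exact: subgroupV.
exact: commutator_eq1.
Qed.

Lemma finite_locally_normal_trivial K :
  locally_normal G K -> finite_set K -> K = [set 1].
Proof.
move=> lK fK; apply: (@discrete_locally_normal_trivial _ (~` (K `\ 1))) => //.
  apply: open_nbhs_nbhs; split; last by move=> [_]; apply.
  apply: closed_openC; apply: compact_closed; first exact: tdlc_hausdorff.
  by apply: finite_compact; exact: finite_setD.
by move=> x [Kx K1x]; apply: contrapT => x1; exact: K1x.
Qed.

(* Start from any element of [V] other than [1] and, for each [B] in turn,
   replace [z] by a commutator of [z] with an element of [B] not commuting
   with it.  The commutator lies in the abelian group [B], and still
   centralises the earlier members of [s] since [V] normalises them. *)
Lemma centralising_element V (s : seq (set G)) : subgroup V -> open V ->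
  (forall B, B \in s -> [/\ subgroup B, V `<=` normaliser B &
     forall x y, B x -> B y -> commute x y]) ->
  exists z, [/\ V z, z <> 1 &
    forall B, B \in s -> forall y, V y -> B y -> commute z y].
Proof.
move=> sV oV; elim: s => [|B s IH] Vs.
  (* If [V] were trivial, every element would be quasi-central and [G] would be trivial. *)
  have [z [Vz z1]] : exists z, V z /\ z <> 1.
    apply: contrapT => nz.
    have nV : nbhs 1 V by exact: open_subgroup_nbhs.
    have V1 z : V z -> z = 1.
      by move=> Vz; apply: contrapT => z1; apply: nz; exists z.
    have [_ [nt _] _] := hG; case: nt.
    apply/seteqP; split=> // x _; apply: quasicentre_trivial.
    apply: nbhsgS nV => y /V1 ->; exact/commute_sym/commute1.
  by exists z; split.
have [|z [Vz z1 zs]] := IH.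
  by move=> C Cs; apply: Vs; rewrite inE Cs orbT.
have [sB VB abB] := Vs B (mem_head _ _).
have [zB|] := pselect (forall y, V y -> B y -> commute z y).
  exists z; split => // C; rewrite inE => /predU1P[->|Cs]; first exact: zB.
  exact: zs.
move=> /existsNP[x /not_implyP[Vx /not_implyP[Bx zx]]].
exists (z * x * z^-1 * x^-1); split.
- apply: subgroupM; [by []| |exact: subgroupV].
  by apply: subgroupM; [|exact: subgroupM|exact: subgroupV].
- by move=> /commutator_eq1.
- move=> C; rewrite inE => /predU1P[->|Cs] y Vy Cy.
    apply: abB => //; apply: subgroupM => //; last exact: subgroupV.
    by apply: normaliserP => //; exact: VB.
  have [_ VC _] : [/\ subgroup C, V `<=` normaliser C &
     forall x y, C x -> C y -> commute x y] by apply: Vs; rewrite inE Cs orbT.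
  (* The commutator is the product of [z] and of the conjugate of [z^-1] by [x]. Both commute with
     the elements of [V] lying in [C], since [x] normalises [V] and [C]. *)
  apply: commute_sym; rewrite -2!mulgA; apply: commuteM.
    by apply/commute_sym/(zs C).
  have -> : y = x * (x^-1 * y * x) * x^-1 by rewrite !mulgA mulgV mul1g mulgK.
  rewrite (mulgA x); apply: commuteJ; apply: commuteV; apply: commute_sym.
  apply: (zs C) => //; last by apply: normaliserVP => //; exact: VC.
  by apply: subgroupM => //; apply: subgroupM => //; exact: subgroupV.
Qed.

(** The conjugate of [B] by [u] depends only on the coset of [u] modulo the open subgroup
    [normaliser B]. *)
Lemma finite_conjugates U B : subgroup U -> compact U -> open (normaliser B) ->
  finite_set [set conjset u B | u in U].
Proof.
move=> sU cU oN; have sN := normaliser_subgroup B.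
have /(virtually_subP sU sN)[E fE EP] := compact_virtually_open sU cU sN oN.
apply: (sub_finite_set _ (finite_image (fun e => conjset e B) fE)).
move=> _ [u /EP[e Ee Ne] <-]; exists e => //=.
by rewrite -[u](mulVKg e) conjsetM Ne.
Qed.

Lemma abelian_locally_normal_trivial A : locally_normal G A ->
  (forall x y, A x -> A y -> commute x y) -> A = [set 1].
Proof.
move=> lA abA; have [sA cA oNA] := lA.
apply/seteqP; split=> x0; last by move=> ->; exact: subgroup1.
move=> Ax0; apply: contrapT => x01.
have [U [sU cU oU _ UT]] := proper_compact_open_subgroup (@filterT _ (nbhs (1 : G)) _).
pose S := [set x | exists g, conjset g A x].
have SJ g x : S x -> S (g * x * g^-1).
  by move=> [h Ax]; exists (g * h); rewrite conjsetM; exists x.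
have Sx0 : S x0 by exists 1; rewrite conjset1.
have [F [fF FS genF]] := finite_generation sU oU SJ Sx0 x01.
(* The value [1] outside [S] only serves to make the choice of a conjugating element total. *)
have S_conj f : exists g, S f -> conjset g A f.
  by have [[g]|nSf] := pselect (S f); [exists g|exists 1].
have [c cP] := choice S_conj.
(* Adding [x0] ensures that some member of the family [J] contains [x0] and is thus not trivial. *)
pose E := x0 |` F.
have ES : E `<=` S by move=> f [->//|/FS].
(* The family is closed under conjugation by [U], which makes [Q] below invariant under [U]. *)
pose J : set (set G) := \bigcup_(f in E) [set conjset u (conjset (c f) A) | u in U].
have fJ : finite_set J.
  apply: bigcup_finite; first by rewrite finite_setU; split.
  move=> f _; apply: finite_conjugates => //.
  by have [] := locally_normalJ (c f) lA.
have EJ f : E f -> exists2 B, J B & B f.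
  move=> Ef; exists (conjset (c f) A); last exact: cP (ES _ Ef).
  by exists f => //; exists 1; [exact: subgroup1|exact: conjset1].
have JU u B : U u -> J B -> J (conjset u B).
  move=> Uu [f Ef [v Uv <-]]; exists f => //; exists (u * v).
    exact: subgroupM.
  by rewrite conjsetM.
have JP B : J B -> [/\ locally_normal G B, subgroup B &
    forall x y, B x -> B y -> commute x y].
  move=> [f _ [v _ <-]]; rewrite -conjsetM; split.
  - exact: locally_normalJ.
  - exact: conjset_subgroup.
  - by move=> x y [a Aa <-] [b Ab <-]; apply: commuteJ; exact: abA.
pose V := \bigcap_(B in J) normaliser B.
have sV : subgroup V.
  apply/subgroupP; split; first by move=> B _; exact: subgroup1 (normaliser_subgroup B).
  move=> x y Vx Vy B JB; apply: (subgroupM (normaliser_subgroup B)); first exact: Vx.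
  by apply: (subgroupV (normaliser_subgroup B)); exact: Vy.
have nV : nbhs 1 V.
  apply: filter_bigcap_finite => // B /JP[[_ _ oN] _ _].
  by apply: open_subgroup_nbhs => //; exact: normaliser_subgroup.
have oV : open V by exact: subgroup_nbhs_open.
have [s Js] : exists s : seq (set G), J = [set` s] by exact/finite_seqP.
have [|z [Vz z1 zP]] := @centralising_element V s sV oV.
  move=> B Bs; have JB : J B by rewrite Js.
  by have [_ sB abB] := JP B JB; split => // x; apply.
pose D x := [set y | forall B, J B -> B y -> commute x y].
pose Q := [set x | nbhs 1 (D x)].
have Qz : Q z.
  by apply: nbhsgS nV => y Vy B JB By; apply: (zP B) => //; rewrite Js in JB.
have NQ : normaliser Q = setT.
  apply: genF; first exact: normaliser_subgroup.
    apply: sub_normaliser => // u x Uu Qx.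
    apply: nbhsgS (nbhs1_conj u^-1 Qx) => y Dy B JB By.
    have -> : y = u * (u^-1 * y * u) * u^-1 by rewrite !mulgA mulgV mul1g mulgK.
    apply: commuteJ; rewrite -[X in _ * X]invgK; apply: (Dy (conjset u^-1 B)).
      by apply: JU => //; exact: subgroupV.
    by exists y.
  move=> f Ff; have [|B JB Bf] := EJ f; first by right.
  have [_ sB _] := JP B JB.
  apply: (sub_normaliser sB) Bf => b x Bb Qx.
  (* For [y] close to [1], the element [b^-1 * y * b * y^-1] is close to [1] and lies in [B], so [x]
     commutes with it. As [x] also commutes with [y] in [C], it commutes with [b^-1 * y * b]. *)
  have c1 : (fun y => b^-1 * y * b * y^-1) @ (1 : G) --> b^-1 * 1 * b * 1^-1.
    apply: cvgMg; last by apply: cvgVg; exact: cvg_id.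
    apply: cvgMg; last exact: cvg_cst.
    by apply: cvgMg; [exact: cvg_cst|exact: cvg_id].
  rewrite mulg1 mulVg mul1g invg1 in c1.
  apply: nbhsgS (nbhsgI nV (nbhsgI Qx (c1 _ Qx))) => y [Vy [Dy Dby]] C JC Cy.
  have -> : y = b * (b^-1 * y * b) * b^-1 by rewrite !mulgA mulgV mul1g mulgK.
  apply: commuteJ; rewrite -[b^-1 * y * b](mulgVK y).
  apply: commuteM; last exact: (Dy C).
  apply: (Dby B) => //; rewrite -!mulgA; apply: subgroupM => //; first exact: subgroupV.
  by rewrite mulgA; apply: normaliserP => //; exact: Vy.
have QJ g x : Q x -> Q (g * x * g^-1).
  by apply: normaliserP; rewrite NQ.
have [F' [fF' FQ F'1]] := finite_trivial_centraliser sU cU oU UT QJ Qz z1.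
have nD : nbhs (1 : G) (\bigcap_(q in F') D q) by exact: filter_bigcap_finite.
have nW := nbhs_core cU (open_subgroup_nbhs sU oU) nD.
have [|B JB Bx0] := EJ x0; first by left.
have [lB _ _] := JP B JB.
apply: x01; suff EB : B = [set 1] by rewrite EB in Bx0.
(* Since [U] permutes [J], all [U]-conjugates of an element of [B] in this core commute with [F'],
   so the element lies in the trivial core of [F'1]. *)
apply: (discrete_locally_normal_trivial lB nW) => y [By [Uy Dy]].
apply: F'1; split=> // u Uu; split=> // q Fq; apply: commute_sym.
apply: (Dy u Uu q Fq (conjset u^-1 B)).
  by apply: JU => //; exact: subgroupV.
by exists y => //; rewrite invgK.
Qed.

End ClassSTheory.

(** * Pseudocomplements *)

Definition pseudocomplementation (d : Order.disp_t) (L : bMeetSemilatticeType d)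
    (p : L -> L) : Prop :=
  forall a b : L, (b <= p a)%O = (Order.meet a b == \bot%O).

Section Pseudocomplement.
Context {d : Order.disp_t} {L : bMeetSemilatticeType d} {p : L -> L}.
Hypothesis pP : pseudocomplementation p.
Local Open Scope order_scope.
Implicit Types a b c : L.

Lemma meet_pc a : a `&` p a = \bot.
Proof. by apply/eqP; rewrite -pP. Qed.

Lemma le_pcpc a : a <= p (p a).
Proof. by rewrite pP meetC meet_pc. Qed.

Lemma le_pc a b : a <= b -> p b <= p a.
Proof.
move=> ab; rewrite pP -lex0; apply: le_trans (leI2 ab (lexx (p b))) _.
by rewrite meet_pc.
Qed.

Lemma pcpcpc a : p (p (p a)) = p a.
Proof. by apply/le_anti/andP; split; [exact/le_pc/le_pcpc|exact: le_pcpc]. Qed.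

Lemma range_pcP a : range p a <-> p (p a) = a.
Proof.
by split=> [[b _ <-]|<-]; [exact: pcpcpc|exists (p a)].
Qed.

Definition pc_join a b := p (p a `&` p b).

Lemma range_pc a : range p (p a). Proof. by exists a. Qed.

Lemma range_pc_join a b : range p (pc_join a b). Proof. exact: range_pc. Qed.

Lemma range_pc_meet a b : range p a -> range p b -> range p (a `&` b).
Proof.
move=> /range_pcP pa /range_pcP pb; apply/range_pcP/le_anti; rewrite le_pcpc andbT.
by rewrite lexI -{2}pa -{3}pb !le_pc// ?leIl ?leIr.
Qed.

(** The map [p] reverses the order and its square fixes [c], so upper bounds turn into lower bounds
    of [p a] and [p b]. *)
Lemma pc_joinP a b c : range p a -> range p b -> range p c ->
  (pc_join a b <= c) = (a <= c) && (b <= c).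
Proof.
move=> /range_pcP pa /range_pcP pb /range_pcP pc; apply/idP/andP => [abc|[ac bc]].
  split; apply: le_trans abc.
    by apply: (le_trans (le_pcpc a)); apply: le_pc; exact: leIl.
  by apply: (le_trans (le_pcpc b)); apply: le_pc; exact: leIr.
by rewrite -pc; apply: le_pc; rewrite lexI !le_pc.
Qed.

Lemma pc_top a : a <= p \bot.
Proof. by rewrite pP meet0x. Qed.

Lemma range_pc_bottom : range p \bot.
Proof.
apply/range_pcP/eqP; rewrite -lex0.
by rewrite -[X in _ <= X](meet_pc (p \bot)) lexI pc_top lexx.
Qed.

(* With [t := p (a `&` b) `&` p (a `&` c)], the element [t `&` a] meets both
   [b] and [c] trivially, so it lies under [p b `&` p c]. *)
Lemma pc_meet_join a b c :
  a `&` pc_join b c <= pc_join (a `&` b) (a `&` c).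
Proof.
rewrite /pc_join pP; set t := p (a `&` b) `&` p (a `&` c).
have tb : t `&` a <= p b.
  rewrite pP -lex0 -(meet_pc (a `&` b)) [X in _ <= X `&` _]meetC 2!lexI leIl /=.
  rewrite (le_trans (leIr _ b) (leIr a t)).
  exact: (le_trans (leIr _ b) (le_trans (leIl t a) (leIl _ _))).
have tc : t `&` a <= p c.
  rewrite pP -lex0 -(meet_pc (a `&` c)) [X in _ <= X `&` _]meetC 2!lexI leIl /=.
  rewrite (le_trans (leIr _ c) (leIr a t)).
  exact: (le_trans (leIr _ c) (le_trans (leIl t a) (leIr _ _))).
rewrite meetA -lex0 -(meet_pc (p b `&` p c)) leI2 //.
by rewrite lexI tb tc.
Qed.

(** The proof is a parameter of the type so that the structures built from it can be inferred from
    the type alone. *)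
Definition skeleton of pseudocomplementation p : Type := set_type (range p).

End Pseudocomplement.

Section Skeleton.
Context {d : Order.disp_t} {L : bMeetSemilatticeType d} {p : L -> L}.
Variable pP : pseudocomplementation p.
Local Open Scope order_scope.
Local Notation T := (skeleton pP).

HB.instance Definition _ := Choice.on T.
HB.instance Definition _ := SubChoice.on T.
HB.instance Definition _ := [SubChoice_isSubPOrder of T by <: with d].

Implicit Types x y z : T.

Lemma skeletonP x : range p (val x). Proof. exact: set_mem (valP x). Qed.

Definition sk_meet x y : T :=
  SigSub (mem_set (range_pc_meet pP (skeletonP x) (skeletonP y))).
Definition sk_join x y : T := SigSub (mem_set (range_pc_join (p := p) (val x) (val y))).
Definition sk_compl x : T := SigSub (mem_set (range_pc (p := p) (val x))).
Definition sk_bottom : T := SigSub (mem_set (range_pc_bottom pP)).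
Definition sk_top : T := SigSub (mem_set (range_pc (p := p) \bot)).

Lemma sk_meetP x y z : (x <= sk_meet y z) = (x <= y) && (x <= z).
Proof. by rewrite !leEsub lexI. Qed.

Lemma sk_joinP x y z : (sk_join x y <= z) = (x <= z) && (y <= z).
Proof. by rewrite !leEsub pc_joinP//; exact: skeletonP. Qed.

HB.instance Definition _ :=
  Order.POrder_MeetJoin_isLattice.Build d T sk_meetP sk_joinP.

Lemma sk_meetUl : @left_distributive T T Order.meet Order.join.
Proof.
move=> x y z; apply/le_anti; rewrite leUx !leI2 ?leUl ?leUr// andbT.
rewrite meetC leEsub (le_trans (pc_meet_join pP _ _ _))//.
by rewrite [x `&` z]meetC [y `&` z]meetC.
Qed.

HB.instance Definition _ := Order.Lattice_Meet_isDistrLattice.Build d T sk_meetUl.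

Lemma sk_le0x x : sk_bottom <= x. Proof. by rewrite leEsub le0x. Qed.

Lemma sk_lex1 x : x <= sk_top. Proof. by rewrite leEsub pc_top. Qed.

HB.instance Definition _ := Order.hasBottom.Build d T sk_le0x.
HB.instance Definition _ := Order.hasTop.Build d T sk_lex1.

Lemma sk_joinxC x : x `|` sk_compl x = \top.
Proof. by apply/val_inj; rewrite /= /pc_join meet_pc. Qed.

Lemma sk_meetxC x : x `&` sk_compl x = \bot.
Proof. by apply/val_inj; rewrite /= meet_pc. Qed.

HB.instance Definition _ :=
  Order.TBDistrLattice_hasComplement.Build d T sk_joinxC sk_meetxC.

Lemma skeleton_boolean :
  is_boolean_lattice_on (range p) (@pc_join d L p) Order.meet p.
Proof. by exists d, (Order.CTBDistrLattice.class T). Qed.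

End Skeleton.

(** * The centraliser lattice *)

Section Centralisers.
Variable G : tdlcGroupType.
Hypothesis hG : in_class_S G.
Implicit Types (g x y : G) (K L N U : set G).

Lemma normalised_locally_normal U K : subgroup U -> open U ->
  subgroup K -> compact K -> U `<=` normaliser K -> locally_normal G K.
Proof.
move=> sU oU sK cK UK; split => //.
apply: subgroup_nbhs_open; first exact: normaliser_subgroup.
by apply: nbhsgS UK _; exact: open_subgroup_nbhs.
Qed.

Lemma centraliser_locally_normal U K : subgroup U -> compact U -> open U ->
  U `<=` normaliser K -> locally_normal G (centraliser_in U K).
Proof.
move=> sU cU oU UK; apply: (@normalised_locally_normal U) => //.
- exact: centraliser_subgroup.
- apply: (subclosed_compact _ cU); last by move=> x [].
  by apply: closed_centraliser; exact: open_subgroup_closed.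
- exact: normaliser_centraliser.
Qed.

(** The intersection is locally normal and abelian: its elements lie in [K] and commute with [K]. *)
Lemma centraliser_disjoint U K : subgroup U -> compact U -> open U ->
  U `<=` normaliser K -> locally_normal G K ->
  K `&` centraliser_in U K = [set 1].
Proof.
move=> sU cU oU UK lK; apply: (abelian_locally_normal_trivial hG).
  by apply: locally_normalI => //; exact: centraliser_locally_normal.
by move=> x y [Kx _] [Ky [_ yK]]; apply: commute_sym; exact: yK.
Qed.

(** The centraliser [D] of the smaller group meets it trivially, so the intersection of [K] and [D]
    is discrete, hence trivial. It contains the commutators of [D] with [K], as each normalises the
    other. *)
Lemma centraliserI_open U N K : subgroup U -> compact U -> open U ->
  subgroup N -> open N -> N `<=` U -> U `<=` normaliser N ->
  K `<=` U -> U `<=` normaliser K -> locally_normal G K ->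
  centraliser_in U (K `&` N) `<=` centraliser_in U K.
Proof.
move=> sU cU oU sN oN NU UN KU UK lK.
have [sK _ _] := lK.
have lN : locally_normal G N.
  apply: (@normalised_locally_normal U) => //.
  by apply: (subclosed_compact _ cU) => //; exact: open_subgroup_closed.
have UKN : U `<=` normaliser (K `&` N).
  by move=> u Uu; rewrite /normaliser /= conjsetI UK// UN.
set D := centraliser_in U _.
have lD : locally_normal G D by exact: centraliser_locally_normal.
have [sD _ _] := lD.
have KD1 : K `&` D = [set 1].
  apply: (discrete_locally_normal_trivial hG _ (open_subgroup_nbhs sN oN)).
    exact: locally_normalI.
  move=> x [[Kx Dx] Nx].
  by rewrite -(centraliser_disjoint sU cU oU UKN (locally_normalI lK lN)).
move=> x Dx; have [Ux _] := Dx; split => // k Kk.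
have : (D `&` K) (x * k * x^-1 * k^-1).
  apply: commutator_normal => //; last exact: UK.
  by apply: normaliser_centraliser => //; exact: KU.
by rewrite setIC KD1; exact: commutator_eq1.
Qed.

Lemma virtually_trivial K : locally_normal G K ->
  virtually_sub K [set 1] -> K = [set 1].
Proof.
move=> lK; have [sK _ _] := lK; have [s1 _ _] := locally_normal1 G.
move=> /(virtually_subP sK s1)[F fF FP]; apply: (finite_locally_normal_trivial hG lK).
apply: (sub_finite_set _ fF) => x /FP[f Ff /= fx].
by rewrite -[x](mulVKg f) fx mulg1.
Qed.

(** This is the universal property of the pseudocomplement. For the converse, the parts of [L] and
    [K] in an open [N] normalising [L] commute, because their commutators lie in [K] and [L]; then
    [centraliserI_open] replaces the part of [K] by [K]. *)
Lemma virtually_sub_centraliser U K L : subgroup U -> compact U -> open U ->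
  K `<=` U -> U `<=` normaliser K -> locally_normal G K -> locally_normal G L ->
  virtually_sub L (centraliser_in U K) <-> K `&` L = [set 1].
Proof.
move=> sU cU oU KU UK lK lL; set C := centraliser_in U K.
have lC : locally_normal G C by exact: centraliser_locally_normal.
have lKL := locally_normalI lK lL.
have [[sK _ _] [sL cL oNL] [sC _ _] [sKL _ _]] := And4 lK lL lC lKL.
split=> [LC|KL1].
  apply: virtually_trivial => //.
  rewrite -(centraliser_disjoint sU cU oU UK lK).
  apply/virtually_subI => //; split; first by apply: virtually_subxx => // x [].
  apply: (virtually_sub_trans sKL sL sC) => //.
  by apply: virtually_subxx => // x [].
have sNL := normaliser_subgroup L.
pose N := core U (normaliser L); have sN : subgroup N by exact: core_subgroup.
have oN : open N.
  apply: subgroup_nbhs_open => //.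
  by apply: nbhs_core => //; exact: open_subgroup_nbhs.
have NU : N `<=` U by move=> x [].
have UN : U `<=` normaliser N by exact: core_normaliser.
have sLN := subgroupI sL sN.
have LLN : virtually_sub L (L `&` N).
  by apply/virtually_subI => //; split;
    [exact: virtually_subxx|exact: compact_virtually_open].
apply: (virtually_sub_trans sL sLN sC LLN); apply: virtually_subxx => // x [Lx Nx].
apply: (centraliserI_open sU cU oU sN oN) => //; split; first exact: NU.
move=> k [Kk Nk].
have : (L `&` K) (x * k * x^-1 * k^-1).
  apply: commutator_normal => //; [exact: (core_sub sU Nk)|].
  by apply: UK; exact: NU.
by rewrite setIC KL1; exact: commutator_eq1.
Qed.

End Centralisers.

(** * Pseudocomplements of classes and the conjugation action *)

Section CentraliserLatticeTheory.
Variable G : tdlcGroupType.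
Hypothesis hG : in_class_S G.
Local Open Scope quotient_scope.
Local Open Scope order_scope.
Implicit Types (a b c : LN G) (K L C : locally_normal G).

Let lnP K : locally_normal G (val K). Proof. exact: set_mem (valP K). Qed.

Lemma piLN_eq0 K : \pi_(LN G) K = \bot <-> val K = [set 1].
Proof.
split=> [/piLN_eq/commensurableE[K1 _]|K1]; first exact: virtually_trivial.
by congr (\pi_(LN G) _); apply: val_inj.
Qed.

(** In particular, all choices of [K] and [U] yield the same class. *)
Lemma is_perpP a b c : is_perp a b -> (c <= b) = (a `&` c == \bot).
Proof.
move=> [K [C [U [-> [sU cU oU] [_ KU UK] CE ->]]]].
rewrite -[c]reprK LN_meetPi; apply/idP/eqP.
  move=> /LN_lePi; rewrite CE => /virtually_sub_centraliser KL.
  by apply/piLN_eq0; exact: KL.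
by move=> /piLN_eq0 KL; apply/LN_lePi; rewrite CE; apply/virtually_sub_centraliser.
Qed.

(** Take [U] compact open in the normaliser of a representative and replace the latter by its
    intersection with [U], which has finite index in it. *)
Lemma is_perp_exists a : exists b, is_perp a b.
Proof.
have lK := lnP (repr a); have [sK cK oN] := lK.
have [U [sU cU oU UN]] :=
  van_dantzig (open_subgroup_nbhs (normaliser_subgroup _) oN).
have UU : U `<=` normaliser U.
  apply: sub_normaliser => // u x Uu Ux.
  by apply: subgroupM; [|exact: subgroupM|exact: subgroupV].
have lU : locally_normal G U by exact: normalised_locally_normal UU.
pose K' := lnI (repr a) (SigSub (mem_set lU)).
have UK' : U `<=` normaliser (val K').
  by move=> u Uu; rewrite /normaliser /= conjsetI UN// UU.
have lC := centraliser_locally_normal sU cU oU UK'.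
exists (\pi_(LN G) (SigSub (mem_set lC))), K', (SigSub (mem_set lC)), U.
have [sK' cK' _] := lnP K'.
split => //.
- rewrite -[LHS]reprK; apply/piLN_eq/commensurableE; split.
    apply/virtually_subI => //; split; first exact: virtually_subxx.
    exact: compact_virtually_open.
  by apply: virtually_subxx => // x [].
- split => //; last by move=> x [].
  by apply: compact_closed => //; exact: tdlc_hausdorff.
Qed.

Lemma perp_pseudocomplementation : pseudocomplementation (@perp G).
Proof.
move=> a b; apply: is_perpP; apply: (xgetPex \bot (P := [set b | is_perp a b])).
exact: is_perp_exists.
Qed.

Lemma LN_conj1 a : LN_conj 1 a = a.
Proof.
rewrite -[a]reprK LN_conjPi; congr (\pi_(LN G) _).
by apply: val_inj; rewrite /= conjset1.
Qed.

Lemma LN_conjM g h a : LN_conj (g * h) a = LN_conj g (LN_conj h a).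
Proof.
rewrite -[a]reprK; move: (repr a) => K.
rewrite (LN_conjPi h) !LN_conjPi; congr (\pi_(LN G) _).
by apply: val_inj; rewrite /= conjsetM.
Qed.

Lemma LN_conjK g : cancel (@LN_conj G g) (LN_conj g^-1).
Proof. by move=> a; rewrite -LN_conjM mulVg LN_conj1. Qed.

Lemma LN_conjVK g : cancel (@LN_conj G g^-1) (LN_conj g).
Proof. by move=> a; rewrite -LN_conjM mulgV LN_conj1. Qed.

Lemma LN_conj_meet g a b : LN_conj g (a `&` b) = LN_conj g a `&` LN_conj g b.
Proof.
rewrite -[a]reprK -[b]reprK; move: (repr a) (repr b) => K L.
rewrite LN_meetPi !LN_conjPi LN_meetPi.
by congr (\pi_(LN G) _); apply: val_inj; rewrite /= conjsetI.
Qed.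

Lemma LN_conj_le g a b : (LN_conj g a <= LN_conj g b) = (a <= b).
Proof.
by rewrite !leEmeet -LN_conj_meet (can_eq (LN_conjK g)).
Qed.

Lemma LN_conj0 g : LN_conj g \bot = \bot :> LN G.
Proof.
by apply/eqP; rewrite -lex0 -[X in _ <= X](LN_conjVK g) LN_conj_le le0x.
Qed.

(** Pseudocomplements are determined by the meet and the order, which conjugation preserves. *)
Lemma LN_conj_perp g a : LN_conj g (perp a) = perp (LN_conj g a).
Proof.
have pP := perp_pseudocomplementation.
apply/le_anti/andP; split.
  by rewrite pP -LN_conj_meet meet_pc// LN_conj0.
rewrite -(LN_conjVK g (perp (LN_conj g a))) LN_conj_le pP.
by rewrite -(can_eq (LN_conjK g)) LN_conj_meet LN_conjVK meet_pc// LN_conj0.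
Qed.

End CentraliserLatticeTheory.

Theorem theorem3 (G : tdlcGroupType) (hG : in_class_S G) :
  is_boolean_lattice_on (@LC G) (@perp_join G) Order.meet (@perp G) /\
  acts_by_automorphisms_on (@LC G) (@perp_join G) Order.meet (@perp G)
    (@LN_conj G).
Proof.
(* [LC G] and [perp_join] unfold to the range of [perp] and to its [pc_join]. *)
split; first exact: skeleton_boolean (perp_pseudocomplementation hG).
have LCJ g (a : LN G) : LC G a -> LC G (LN_conj g a).
  by move=> [b _ <-]; rewrite LN_conj_perp//; exists (LN_conj g b).
split=> [a _|g h a _|g]; [exact: LN_conj1|exact: LN_conjM|split].
- split=> [a /LCJ //|a b _ _ /(can_inj (LN_conjK g)) //|a La].
  by exists (LN_conj g^-1 a); [exact: LCJ|exact: LN_conjVK].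
- by move=> a b _ _; rewrite /perp_join LN_conj_perp// LN_conj_meet !LN_conj_perp.
- by move=> a b _ _; exact: LN_conj_meet.
- by move=> a _; exact: LN_conj_perp.
Qed.
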